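(* Let $u:[0,1]\to\mathbb{R}$ be bounded, piecewise continuous and upper semi-continuous, and fix $r,\sigma>0$ and a prior $p_0\in[0,1]$. For each $\bar\lambda>0$ let $v_{\bar\lambda}:[0,1]\to\mathbb{R}$ be the value function $$v_{\bar\lambda}(q)=\sup_{(\lambda_t)_{t\ge 0}}\mathbb{E}\left(r\int_0^\infty e^{-rt}u(p_t)\,\mathrm{d}t\right)\quad\text{s.t.}\quad \mathrm{d}p_t=\sqrt{\lambda_t}\,\frac{p_t(1-p_t)}{\sigma}\,\mathrm{d}B_t,$$ where $q\in[0,1]$ is the initial condition of $(p_t)_{t\ge0}$ and the supremum is over admissible $[0,\bar\lambda]$-valued controls, and define $$p^-_{\bar\lambda}=\sup\{p\in[0,p_0]:v_{\bar\lambda}(p)=u(p)\},\qquad p^+_{\bar\lambda}=\inf\{p\in[p_0,1]:v_{\bar\lambda}(p)=u(p)\}.$$ Then, as $\bar\lambda$ increases, $p^-_{\bar\lambda}$ (weakly) decreases and $p^+_{\bar\lambda}$ (weakly) increases.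
   Context: A function $[0,1]\to\mathbb{R}$ is piecewise continuous iff its set of discontinuities is a discrete subset of $(0,1)$ (every member is an isolated point of the set); in particular it is continuous at $0$ and $1$. Admissible controls: given an initial condition $q$, a control consists of a $[0,\bar\lambda]$-valued (measurable) process $(\lambda_t)_{t\ge0}$ and a $[0,1]$-valued process $(p_t)_{t\ge0}$ started at $q$ on a probability space carrying a standard Brownian motion $B$, such that $\mathrm{d}p_t=\sqrt{\lambda_t}\,\frac{p_t(1-p_t)}{\sigma}\,\mathrm{d}B_t$ and $(\lambda_t)$ is adapted to the filtration generated by $(p_t)_{t\ge0}$. *)

(* Defs.v *)
From HB Require Import structures.
From mathcomp Require Import all_boot all_order all_algebra.
From mathcomp Require Import all_classical all_reals all_analysis.
Import Order.TTheory GRing.Theory Num.Theory numFieldNormedType.Exports.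

Set Implicit Arguments.
Unset Strict Implicit.
Unset Printing Implicit Defensive.

Local Open Scope classical_set_scope.
Local Open Scope ring_scope.

(* Functions on [0, 1] are represented by functions R -> R of which only the
   restriction to [0, 1] matters: limits are taken within `[0, 1]. *)
Section functions_on_the_unit_interval.
Context {R : realType}.
Implicit Types u : R -> R.

Definition discontinuities u : set R :=
  [set x : R | x \in `[0, 1] /\
           ~ (u y @[y --> within `[0, 1]%classic (nbhs x)] --> u x)].

Definition piecewise_continuous u : Prop :=
  discontinuities u `<=` `]0, 1[%classic /\
  discontinuities u `<=` isolated (discontinuities u).

Definition upper_semicontinuous u : Prop :=
  forall x a : R, x \in `[0, 1] -> u x < a ->
    \forall y \near within `[0, 1]%classic (nbhs x), u y < a.

End functions_on_the_unit_interval.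

(* A process is a function X : R -> W -> R, where X t is the value at time t;
   only the times t >= 0 matter. *)
Section processes.
Context {R : realType} {d : measure_display} {W : measurableType d}.
Implicit Types (X : R -> W -> R) (F : R -> set (set W)) (s t : R).

Definition measurable_process X : Prop :=
  measurable_fun (`[0%R : R, +oo[%classic `*` [set: W]) (fun z : R * W => X z.1 z.2).

Definition filtration F : Prop :=
  (forall t : R, 0 <= t -> sigma_algebra [set: W] (F t) /\ F t `<=` measurable) /\
  (forall s t : R, 0 <= s -> s <= t -> F s `<=` F t).

Definition measurable_wrt (G : set (set W)) (Y : W -> R) : Prop :=
  preimage_set_system [set: W] Y measurable `<=` G.

Definition adapted F X : Prop :=
  forall t : R, 0 <= t -> measurable_wrt (F t) (X t).

Definition natural_filtration X (t : R) : set (set W) :=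
  <<s \bigcup_(s in `[0, t]%classic)
        preimage_set_system [set: W] (X s) measurable >>.

Definition increment (B : R -> W -> R) s t (w : W) : R := B t w - B s w.

Record brownian_motion (P : probability W R) F (B : R -> W -> R) : Prop := {
  bm_adapted : adapted F B ;
  bm_start : {ae P, forall w, B 0 w = 0} ;
  bm_continuous : {ae P, forall w,
    {within `[0, +oo[%classic, continuous (fun t => B t w)}} ;
  bm_independent : forall s t : R, 0 <= s -> s < t ->
    forall (A : set W) (C : set R), F s A -> measurable C ->
      P (A `&` increment B s t @^-1` C) = (P A * P (increment B s t @^-1` C))%E ;
  bm_normal : forall s t : R, 0 <= s -> s < t ->
    forall C : set R, measurable C ->
      P (increment B s t @^-1` C) = normal_prob 0 (Num.sqrt (t - s)) C }.

(* the process \sum_(i < n) xi_i 1_]t_i, t_(i+1)], with n = sp_size,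
   t_i = sp_time i and xi_i = sp_val i *)
Record simple_process F := SimpleProcess {
  sp_size : nat ;
  sp_time : nat -> R ;
  sp_val : nat -> W -> R ;
  sp_time_ge0 : 0 <= sp_time 0 ;
  sp_time_homo : {homo sp_time : i j / (i <= j)%N >-> i <= j} ;
  sp_val_bounded : forall i, exists M : R, forall w, `|sp_val i w| <= M ;
  sp_val_measurable : forall i, measurable_wrt (F (sp_time i)) (sp_val i) }.

Definition sp_fun F (S : simple_process F) (t : R) (w : W) : R :=
  \sum_(i < sp_size S)
    sp_val S i w * \1_(`]sp_time S i, sp_time S i.+1]%classic) t.

Definition sp_integral F (S : simple_process F) (B : R -> W -> R) (t : R)
    (w : W) : R :=
  \sum_(i < sp_size S) sp_val S i w *
    (B (Num.min (sp_time S i.+1) t) w - B (Num.min (sp_time S i) t) w).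

(* The random variable I is (a version of) the Ito integral of H with respect
   to B on [0, t]: the L^2(P)-limit of the elementary integrals of simple
   processes that converge to H in L^2([0, t] x W). *)
Definition ito_integral (P : probability W R) F (B H : R -> W -> R) (t : R)
    (I : W -> R) : Prop :=
  [/\ measurable_process H, adapted F H, measurable_fun [set: W] I &
    exists S : nat -> simple_process F,
      (\int[P]_w \int[lebesgue_measure]_(s in `[0%R, t])
          ((H s w - sp_fun (S n) s w) ^+ 2)%:E)%E @[n --> \oo] --> 0%E /\
      ('E_P[fun w => ((I w - sp_integral (S n) B t w) ^+ 2)%R])%E
        @[n --> \oo] --> 0%E].

End processes.

Section control_problem.
Context {R : realType}.
Implicit Types (u : R -> R) (r sigma lambdabar q : R).

(* dp_t = sqrt(lambda_t) * (p_t (1 - p_t) / sigma) dB_t with p_0 = q, in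
   integral form; F is a filtration for which B is a Brownian motion and to
   which p is adapted. *)
Record admissible sigma lambdabar q d (W : measurableType d)
    (P : probability W R) (F : R -> set (set W))
    (B lambda p : R -> W -> R) : Prop := {
  adm_filtration : filtration F ;
  adm_brownian : brownian_motion P F B ;
  adm_lambda_measurable : measurable_process lambda ;
  adm_lambda_range : forall (t : R) (w : W), 0 <= t -> lambda t w \in `[0, lambdabar] ;
  adm_lambda_adapted : adapted (natural_filtration p) lambda ;
  adm_p_adapted : adapted F p ;
  adm_p_continuous : forall w,
    {within `[0, +oo[%classic, continuous (fun t => p t w)} ;
  adm_p_range : forall (t : R) (w : W), 0 <= t -> p t w \in `[0, 1] ;
  adm_p_start : forall w, p 0 w = q ;
  adm_sde : forall t : R, 0 <= t ->
    ito_integral P F B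
      (fun s w => Num.sqrt (lambda s w) * (p s w * (1 - p s w) / sigma))
      t (fun w => p t w - q) }.

Definition payoff u r d (W : measurableType d) (P : probability W R)
    (p : R -> W -> R) : R :=
  fine 'E_P[fun w =>
    (r * \int[lebesgue_measure]_(t in `[0, +oo[)
           (expR (- r * t) * u (p t w)))%R]%E.

(* The probability space, the filtration and the Brownian motion are part of
   the control (weak formulation). *)
Definition value u r sigma lambdabar q : R :=
  sup [set y : R | exists (d : measure_display) (W : measurableType d)
                      (P : probability W R) (F : R -> set (set W))
                      (B lambda p : R -> W -> R),
                 admissible sigma lambdabar q P F B lambda p /\
                 y = payoff u r P p].

Definition pminus u r sigma p0 lambdabar : R :=
  sup [set p : R | p \in `[0, p0] /\ value u r sigma lambdabar p = u p].

Definition pplus u r sigma p0 lambdabar : R :=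
  inf [set p : R | p \in `[p0, 1] /\ value u r sigma lambdabar p = u p].

End control_problem.

(* Main.v *)
Require Import Defs.
From HB Require Import structures.
From mathcomp Require Import all_boot all_order all_algebra.
From mathcomp Require Import all_classical all_reals all_analysis.
From mathcomp Require Import measurable_realfun ring lra.
Import Order.TTheory GRing.Theory Num.Theory numFieldNormedType.Exports.

Local Open Scope classical_set_scope.
Local Open Scope ring_scope.

(* A larger bound on the controls only adds controls, and the control 0 freezes
   the state, so u <= v_l1 <= v_l2 on [0, 1] for l1 <= l2; hence v_l2 = u forces
   v_l1 = u, and the sup and inf defining p^- and p^+ are taken over smaller sets
   for l2.  These sets may be empty, and sup and inf of the empty set are 0:
   harmless for the sup over a subset of [0, p0], but for the inf one needs
   v_l2 1 = u 1.  There, Ito integrals have mean zero, so E[p_t] = 1 with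
   p_t <= 1, and continuity of paths gives p_t = 1 for all t, almost surely. *)

(** * Comparison of integrals by way of simple functions *)

(* Stated for arbitrary integrands, so that the payoff can be estimated without
   proving the measurability of u(p_t). *)
Section nonmeasurable_integrands.
Local Open Scope ereal_scope.
Context d (T : measurableType d) (R : realType) (mu : {measure set T -> \bar R}).
Implicit Types (D : set T) (f g : T -> \bar R).
Import HBNNSimple.

(** The integral of a nonnegative function is the supremum of the integrals of the simple functions
    below it, and a simple function below [f] is also below [g]. *)
Lemma ge0_le_integral_nonmeasurable D f g :
  (forall x, D x -> 0 <= f x) -> (forall x, D x -> f x <= g x) ->
  \int[mu]_(x in D) f x <= \int[mu]_(x in D) g x.
Proof.
move=> f0 fg; have g0 x : D x -> 0 <= g x.
  by move=> Dx; apply: le_trans (fg _ Dx); exact: f0.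
rewrite !ge0_integralE//; apply: le_ereal_sup => _ [h hf <-]; exists h => // x.
by apply: le_trans (hf x) _; rewrite !patchE; case: ifPn => // /set_mem; exact: fg.
Qed.

(** Both [f^\+] and [f^\-] are dominated by [g], so their integrals lie in [[0, G]], and two numbers
    of that interval differ by at most [G]. Additivity of the integral, which would call for
    measurability, is avoided. *)
Lemma abse_integral_le_nonmeasurable D f g (G : R) :
  (forall x, D x -> `|f x| <= g x) -> \int[mu]_(x in D) g x = G%:E ->
  `|\int[mu]_(x in D) f x| <= G%:E.
Proof.
move=> fg gG; rewrite integralE.
have fpG : \int[mu]_(x in D) f^\+ x <= G%:E.
  rewrite -gG; apply: ge0_le_integral_nonmeasurable => // x Dx.
  by rewrite (le_trans _ (fg _ Dx))// funeposE ge_max lee_abs abse_ge0.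
have fnG : \int[mu]_(x in D) f^\- x <= G%:E.
  rewrite -gG; apply: ge0_le_integral_nonmeasurable => // x Dx.
  by rewrite (le_trans _ (fg _ Dx))// funenegE ge_max -abseN lee_abs abse_ge0.
have : 0 <= \int[mu]_(x in D) f^\+ x by exact: integral_ge0.
have : 0 <= \int[mu]_(x in D) f^\- x by exact: integral_ge0.
move: fpG fnG; case: (\int[mu]_(x in D) f^\+ x) => [a| |]//.
case: (\int[mu]_(x in D) f^\- x) => [b| |]//.
by rewrite -EFinB abse_EFin !lee_fin ler_norml => *; lra.
Qed.

(** A simple function below [f] is measurable, so cutting it off on the null set [N] keeps its
    integral; what remains lies below [g]. *)
Lemma ge0_ae_le_integral_nonmeasurable f g (N : set T) :
  measurable N -> mu N = 0 -> (forall x, 0 <= f x) -> (forall x, 0 <= g x) ->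
  (forall x, ~ N x -> f x = g x) -> \int[mu]_x f x <= \int[mu]_x g x.
Proof.
move=> mN N0 f0 g0 fg; rewrite [leLHS]ge0_integralTE//.
apply: ge_ereal_sup => _ [h hf <-].
have -> : sintegral mu h = \int[mu]_x (h x)%:E.
  by rewrite integral_nnsfun// patch_setT.
rewrite (@ge0_negligible_integral _ _ _ _ setT N)//; last 2 first.
- exact/measurable_EFinP.
- by move=> x _; rewrite lee_fin.
rewrite setTD integral_mkcond; apply: ge0_le_integral_nonmeasurable => x _.
  by apply: erestrict_ge0 => y _; rewrite lee_fin.
rewrite patchE; case: ifPn => [/set_mem /fg <-|_]//; exact: hf.
Qed.

Lemma ae_eq_integral_nonmeasurable f g (N : set T) :
  measurable N -> mu N = 0 -> (forall x, ~ N x -> f x = g x) ->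
  \int[mu]_x f x = \int[mu]_x g x.
Proof.
move=> mN N0 fg; rewrite integralE [RHS]integralE.
have fgp x : ~ N x -> f^\+ x = g^\+ x by move=> /fg; rewrite !funeposE => ->.
have fgn x : ~ N x -> f^\- x = g^\- x by move=> /fg; rewrite !funenegE => ->.
by congr (_ - _); apply/eqP; rewrite eq_le; apply/andP; split;
  apply: (ge0_ae_le_integral_nonmeasurable _ _ N) => // x Nx;
  rewrite (fgp, fgn).
Qed.

End nonmeasurable_integrands.

(** * Integrability and mean of the centred normal law *)

Section normal_mean.
Context {R : realType}.
Local Notation mu := (@lebesgue_measure R).
Implicit Type s : R.

(** The change of variables is available for the Radon-Nikodym derivative, which equals [normal_pdf]
    almost everywhere because the two have the same integral over every measurable set. *)
Lemma ge0_integral_normal_prob s (f : R -> \bar R) :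
  (forall x, 0 <= f x)%E -> measurable_fun [set: R] f ->
  (\int[normal_prob 0 s]_x f x = \int[mu]_x (f x * (normal_pdf 0 s x)%:E))%E.
Proof.
move=> f0 mf; have dom := normal_prob_dominates 0 s.
rewrite -(Radon_Nikodym_SigmaFinite.change_of_variables dom)//.
have iRN := Radon_Nikodym_SigmaFinite.f_integrable dom.
apply: ae_eq_integral => //.
- by apply: emeasurable_funM => //; exact: measurable_int iRN.
- apply: emeasurable_funM => //; apply/measurable_EFinP.
  exact: measurable_normal_pdf.
- apply: ae_eqe_mul2l; apply: integral_ae_eq => //.
    by apply/measurable_EFinP; exact: measurable_normal_pdf.
  by move=> E _ mE; rewrite -(Radon_Nikodym_SigmaFinite.f_integral dom).
Qed.

(** The factor [|x|] is absorbed by doubling the standard deviation, which yields an integrable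
    majorant. With [y = x^2 / (2 s^2)] the exponent for [2 * s] is [- y + 3/4 y], so the claim
    reduces to [|x| <= s * expR (3/4 y)]; this follows from [1 + a <= expR a] and a completed
    square. *)
Lemma normr_mul_normal_pdf_le s x : 0 < s ->
  `|x| * normal_pdf 0 s x <=
    s * normal_peak s / normal_peak (2 * s) * normal_pdf 0 (2 * s) x.
Proof.
move=> s0; have s20 : 0 < 2 * s by rewrite mulr_gt0.
have peak20 : 0 < normal_peak (2 * s) by rewrite normal_peak_gt0 ?gt_eqF.
have peak0 : 0 < normal_peak s by rewrite normal_peak_gt0 ?gt_eqF.
rewrite !normal_pdfE ?gt_eqF// [leRHS]mulrA divfK ?gt_eqF//.
rewrite mulrCA [s * _]mulrC -mulrA ler_pM2l// /normal_fun subr0.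
set y := x ^+ 2 / (s ^+ 2 *+ 2).
have -> : - x ^+ 2 / (s ^+ 2 *+ 2) = - y by rewrite mulNr.
have -> : - x ^+ 2 / ((2 * s) ^+ 2 *+ 2) = - y + 3 / 4 * y.
  by rewrite /y; field; rewrite gt_eqF.
rewrite expRD mulrCA mulrC ler_pM2l ?expR_gt0//.
apply: (@le_trans _ _ (s * (1 + 3 / 4 * y))); last first.
  by rewrite ler_pM2l// expR_ge1Dx.
have -> : s * (1 + 3 / 4 * y) = s + 3 / 8 * (`|x| ^+ 2 / s).
  by rewrite real_normK ?num_real// /y; field; rewrite gt_eqF.
rewrite -subr_ge0.
have -> : s + 3 / 8 * (`|x| ^+ 2 / s) - `|x| =
    ((s - `|x| / 2) ^+ 2 + `|x| ^+ 2 / 8) / s.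
  by field; rewrite gt_eqF.
by rewrite divr_ge0 ?(ltW s0)// addr_ge0 ?sqr_ge0// divr_ge0 ?sqr_ge0.
Qed.

Lemma integrable_normal_prob_id s : 0 < s ->
  (normal_prob 0 s).-integrable [set: R] EFin.
Proof.
move=> s0; apply/integrableP; split; first exact/measurable_EFinP.
rewrite ge0_integral_normal_prob//; last first.
  by apply: measurableT_comp => //; exact/measurable_EFinP.
set k := s * normal_peak s / normal_peak (2 * s).
apply: (@le_lt_trans _ _
    (\int[mu]_x (k%:E * (normal_pdf 0 (2 * s) x)%:E))%E).
  apply: ge0_le_integral_nonmeasurable => x _.
    by rewrite mule_ge0// lee_fin normal_pdf_ge0.
  by rewrite -!EFinM lee_fin; exact: normr_mul_normal_pdf_le.
rewrite integralZl//; last exact: integrable_normal_pdf.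
by rewrite integral_normal_pdf mule1 ltry.
Qed.

(** The density is even and Lebesgue measure is invariant under reflection. *)
Lemma normal_prob_opp s (A : set R) : s != 0 -> measurable A ->
  normal_prob 0 s (-%R @^-1` A) = normal_prob 0 s A.
Proof.
move=> s0 mA; rewrite /normal_prob.
transitivity (\int[mu]_(x in -%R @^-1` A) (normal_pdf 0 s (- x))%:E)%E.
  by apply: eq_integral => x _; rewrite !normal_pdfE// /normal_fun !subr0 sqrrN.
rewrite -(@ge0_integral_pushforward _ _ (measurableTypeR R) (measurableTypeR R)
  R -%R _ _ A (fun x => (normal_pdf 0 s x)%:E))//.
- by apply: eq_measure_integral => B mB _; exact: lebesgue_measureN.
- by apply/measurable_EFinP/measurable_funTS; exact: measurable_normal_pdf.
- by move=> x _; rewrite lee_fin normal_pdf_ge0.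
Qed.

(** By symmetry of the law the mean equals its own opposite; being finite by integrability, it is
    zero. *)
Lemma integral_normal_prob_id s : 0 < s ->
  (\int[normal_prob 0 s]_x x%:E = 0)%E.
Proof.
move=> s0; have idN := integrable_normal_prob_id _ s0.
have : (\int[normal_prob 0 s]_x x%:E = - \int[normal_prob 0 s]_x x%:E)%E.
  rewrite -[RHS]integralN; last first.
    exact: integrable_add_def.
  have mopp : measurable_fun [set: measurableTypeR R] (-%R : measurableTypeR R -> measurableTypeR R).
    exact: oppr_measurable.
  pose oppm : {RV (normal_prob 0 s) >-> measurableTypeR R} :=
    HB.pack (-%R : measurableTypeR R -> measurableTypeR R)
      (isMeasurableFun.Build _ _ (measurableTypeR R) (measurableTypeR R) -%R mopp).
  transitivity (\int[distribution (normal_prob 0 s) oppm]_x x%:E)%E.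
    apply: eq_measure_integral => A mA _ /=.
    by rewrite /distribution/= /pushforward normal_prob_opp// gt_eqF.
  by rewrite integral_distribution//; exact: (integrableN idN).
have := integrable_fin_num measurableT idN.
case: (integral _ _ _) => // a _ [aN]; congr EFin; lra.
Qed.

End normal_mean.

(** * Expectation of a product of independent variables *)

Section independence.
Local Open Scope ereal_scope.
Context d (T : measurableType d) (R : realType) (P : probability T R).

(* Independence makes the joint law of X and Y a product measure; the formula
   is then Fubini's theorem. *)
Lemma integralM_independent (X Y : T -> R) :
  measurable_fun [set: T] X -> measurable_fun [set: T] Y ->
  (forall A B : set R, measurable A -> measurable B ->
    P (X @^-1` A `&` Y @^-1` B) = P (X @^-1` A) * P (Y @^-1` B)) ->
  P.-integrable [set: T] (EFin \o X) -> P.-integrable [set: T] (EFin \o Y) ->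
  P.-integrable [set: T] (fun w => (X w * Y w)%:E) ->
  \int[P]_w (X w * Y w)%:E = \int[P]_w (X w)%:E * \int[P]_w (Y w)%:E.
Proof.
move=> mX mY XY iX iY iXY.
have mXY : measurable_fun setT (fun w => (X w, Y w)) by exact: measurable_fun_pair.
pose X' : {RV P >-> R} := HB.pack X (isMeasurableFun.Build _ _ _ _ X mX).
pose Y' : {RV P >-> R} := HB.pack Y (isMeasurableFun.Build _ _ _ _ Y mY).
pose Z' : {RV P >-> (R * R)%type} := HB.pack (fun w => (X w, Y w)) (isMeasurableFun.Build _ _ _ _ _ mXY).
pose f (z : (R * R)%type) := (z.1 * z.2)%:E.
have mf : measurable_fun setT f.
  by apply/measurable_EFinP; exact: measurable_funM.
have ZE (A : set (R * R)%type) : measurable A ->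
    (distribution P X' \x distribution P Y') A = distribution P Z' A.
  by apply: product_measure_unique => B C mB mC; rewrite -XY.
have iZ : (distribution P Z').-integrable setT f.
  by apply: integrable_pushforward.
have iXY' : (distribution P X' \x distribution P Y').-integrable setT f.
  apply/integrableP; split=> //.
  rewrite (@eq_measure_integral _ _ _ _ (distribution P Z')).
    by case/integrableP: iZ.
  by move=> A mA _; exact: ZE.
have iX' : (distribution P X').-integrable setT EFin.
  by apply: integrable_pushforward => //; exact/measurable_EFinP.
have iY' : (distribution P Y').-integrable setT EFin.
  by apply: integrable_pushforward => //; exact/measurable_EFinP.
have EY : \int[distribution P Y']_y y%:E = \int[P]_w (Y w)%:E.
  by rewrite integral_distribution//; exact/measurable_EFinP.
have EX : \int[distribution P X']_y y%:E = \int[P]_w (X w)%:E.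
  by rewrite integral_distribution//; exact/measurable_EFinP.
transitivity (\int[distribution P X' \x distribution P Y']_z f z).
  rewrite (@eq_measure_integral _ _ _ _ (distribution P Z'))//.
    by rewrite integral_distribution.
  by move=> A mA _; exact: ZE.
(* The inner integral is [x] times the mean of [Y]; this mean is finite, hence can be taken out of
   the outer integral as a real factor. *)
rewrite -integral12_prod_meas1// -EX -EY.
rewrite -(fineK (integrable_fin_num measurableT iY')) -integralZr//.
apply: eq_integral => x _; rewrite fineK ?integrable_fin_num//.
by rewrite -integralZl.
Qed.

End independence.

(** * Elementary and Ito integrals have mean zero *)

Section brownian_motion_theory.
Context {R : realType} {d : measure_display} {W : measurableType d}.
Variables (P : probability W R) (F : R -> set (set W)) (B : R -> W -> R).
Hypotheses (F_filtration : filtration F) (BM : brownian_motion P F B).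

Lemma measurable_wrt_measurable_fun t (Y : W -> R) :
  0 <= t -> measurable_wrt (F t) Y -> measurable_fun [set: W] Y.
Proof.
move=> t0 Yt _ A mA; have [_ Fm] := F_filtration.1 t t0.
by apply/Fm/Yt; exists A.
Qed.

Lemma measurable_brownian_motion t : 0 <= t -> measurable_fun [set: W] (B t).
Proof.
by move=> t0; apply: (measurable_wrt_measurable_fun t) => //; exact: bm_adapted BM t t0.
Qed.

Lemma measurable_increment s t : 0 <= s -> 0 <= t ->
  measurable_fun [set: W] (increment B s t).
Proof. by move=> s0 t0; apply: measurable_funB; exact: measurable_brownian_motion. Qed.

Lemma integrable_increment s t : 0 <= s -> s < t ->
  P.-integrable [set: W] (EFin \o increment B s t).
Proof.
move=> s0 st; have t0 : 0 <= t by rewrite (le_trans s0)// ltW.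
have mi := measurable_increment _ _ s0 t0.
pose X : {RV P >-> measurableTypeR R} :=
  HB.pack (increment B s t : W -> measurableTypeR R)
    (isMeasurableFun.Build _ _ W (measurableTypeR R) (increment B s t) mi).
have st0 : 0 < Num.sqrt (t - s) by rewrite sqrtr_gt0 subr_gt0.
apply/integrableP; split; first exact/measurable_EFinP.
have mabs : measurable_fun [set: R] (fun x : R => `|x%:E|%E).
  by apply: measurableT_comp => //; exact/measurable_EFinP.
have -> : (\int[P]_w `|(EFin \o increment B s t) w| =
           \int[distribution P X]_x `|x%:E|)%E.
  by rewrite ge0_integral_distribution.
rewrite (@eq_measure_integral _ _ _ _ (normal_prob 0 (Num.sqrt (t - s)))).
  by case/integrableP: (integrable_normal_prob_id _ st0).
by move=> A mA _; exact: (bm_normal BM).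
Qed.

Lemma integral_increment s t : 0 <= s -> s < t ->
  (\int[P]_w (increment B s t w)%:E = 0)%E.
Proof.
move=> s0 st; have t0 : 0 <= t by rewrite (le_trans s0)// ltW.
have mi := measurable_increment _ _ s0 t0.
pose X : {RV P >-> measurableTypeR R} :=
  HB.pack (increment B s t : W -> measurableTypeR R)
    (isMeasurableFun.Build _ _ W (measurableTypeR R) (increment B s t) mi).
have st0 : 0 < Num.sqrt (t - s) by rewrite sqrtr_gt0 subr_gt0.
have -> : (\int[P]_w (increment B s t w)%:E = \int[distribution P X]_x x%:E)%E.
  by rewrite integral_distribution//; exact: integrable_increment.
rewrite (@eq_measure_integral _ _ _ _ (normal_prob 0 (Num.sqrt (t - s)))).
  exact: integral_normal_prob_id.
by move=> A mA _; exact: (bm_normal BM).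
Qed.

(** The increment is independent of [F s], to which [xi] belongs, so the expectation factors, and
    the increment has mean zero. Boundedness of [xi] makes the product integrable. *)
Lemma integral_mul_increment s t (xi : W -> R) (M : R) : 0 <= s -> s <= t ->
  measurable_wrt (F s) xi -> (forall w, `|xi w| <= M) ->
  P.-integrable [set: W] (fun w => (xi w * increment B s t w)%:E) /\
  (\int[P]_w (xi w * increment B s t w)%:E = 0)%E.
Proof.
(* The law and the independence of increments are given for [s < t] only; for [s = t] the product is
   identically 0. *)
move=> s0; rewrite le_eqVlt => /predU1P[<- _ _|st xis xiM].
  have -> : (fun w => (xi w * increment B s s w)%:E) = cst 0%E.
    by apply/funext => w; rewrite /increment subrr mulr0.
  by split; [exact: integrable0|exact: integral0].
have mxi : measurable_fun [set: W] xi.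
  by apply: (measurable_wrt_measurable_fun s).
have bxi : [bounded xi w | w in [set: W]].
  by exists M; split; [exact: num_real|move=> x Mx w _ /=; rewrite (le_trans (xiM w))// ltW].
have iD := integrable_increment _ _ s0 st.
have ixi : P.-integrable [set: W] (EFin \o xi).
  apply: measurable_bounded_integrable => //.
  by apply: le_lt_trans (probability_le1 P measurableT) _; rewrite ltry.
have ixiD : P.-integrable [set: W] (fun w => (xi w * increment B s t w)%:E).
  apply: eq_integrable (integrableMr measurableT mxi bxi iD) => //.
split=> //; rewrite integralM_independent//.
- by rewrite integral_increment// mule0.
- by apply: measurable_increment => //; rewrite (le_trans s0)// ltW.
- move=> A C mA mC; apply: (bm_independent BM) => //; apply: xis.
  by exists A => //; rewrite setTI.
Qed.

Lemma integral_sp_integral (S : simple_process F) t : 0 <= t ->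
  P.-integrable [set: W] (EFin \o sp_integral S B t) /\
  (\int[P]_w (sp_integral S B t w)%:E = 0)%E.
Proof.
move=> t0; pose h i w := (sp_val S i w *
  (B (Num.min (sp_time S i.+1) t) w - B (Num.min (sp_time S i) t) w))%:E.
have hE w : (sp_integral S B t w)%:E = (\sum_(i < sp_size S) h i w)%E.
  by rewrite sumEFin.
have hi i : P.-integrable [set: W] (h i) /\ (\int[P]_w h i w = 0)%E.
  have ti0 : 0 <= sp_time S i.
    by rewrite (le_trans (sp_time_ge0 S))// sp_time_homo.
  have tii : sp_time S i <= sp_time S i.+1 by exact: sp_time_homo.
  have [M xiM] := sp_val_bounded S i.
  have [tit|tti] := leP (sp_time S i) t.
    rewrite /h (min_idPl tit); apply: (integral_mul_increment _ _ _ M) => //.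
      by rewrite le_min tii.
    exact: sp_val_measurable.
  (* For an interval that starts after [t], both endpoints are truncated to [t] and the increment
     vanishes. *)
  have -> : h i = cst 0%E.
    apply/funext => w; rewrite /h (min_idPr (ltW tti)) (min_idPr _).
      by rewrite subrr mulr0.
    by rewrite (le_trans _ tii)// ltW.
  by split; [exact: integrable0|exact: integral0].
rewrite (_ : EFin \o _ = fun w => \sum_(i < sp_size S) h i w)%E; last exact/funext.
split; first by apply: integrable_sum => // i _; exact: (hi i).1.
under eq_integral do rewrite hE.
by rewrite integral_sum ?big1// => i; have [] := hi i.
Qed.

(** Elementary integrals have mean zero, so the mean of [I] is that of [I - X] for any elementary
    integral [X], and is small once [X] is close to [I] in [L^2]. *)
Lemma integral_ito_integral (H : R -> W -> R) t (I : W -> R) : 0 <= t ->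
  ito_integral P F B H t I -> P.-integrable [set: W] (EFin \o I) ->
  (\int[P]_w (I w)%:E = 0)%E.
Proof.
move=> t0 [_ _ mI [S [_ cvgS]]] iI.
suff small (e : R) : 0 < e -> (`|\int[P]_w (I w)%:E| <= e%:E)%E.
  have := integrable_fin_num measurableT iI; move: small.
  rewrite /comp/=; case: (integral _ _ _) => // a small _.
  congr EFin; apply/eqP; rewrite -normr_le0; apply/ler_addgt0Pl => e e0.
  by rewrite addr0 -lee_fin small.
move=> e0; have /fine_cvgP[finS /cvgrPdist_lt cvgS'] := cvgS.
have [n [fin_n En]] : exists n,
    ('E_P[fun w => ((I w - sp_integral (S n) B t w) ^+ 2)%R])%E \is a fin_num /\
    `|0 - fine ('E_P[fun w => ((I w - sp_integral (S n) B t w) ^+ 2)%R])%E| < e ^+ 2.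
  have e20 : 0 < e ^+ 2 by rewrite exprn_gt0.
  have : \forall n \near \oo,
    ('E_P[fun w => ((I w - sp_integral (S n) B t w) ^+ 2)%R])%E \is a fin_num /\
    `|0 - fine ('E_P[fun w => ((I w - sp_integral (S n) B t w) ^+ 2)%R])%E| < e ^+ 2.
    by near=> n; split; near: n => //; exact: cvgS'.
  by case=> N _ /(_ N (leqnn N)) ?; exists N.
have [iS ES] := integral_sp_integral (S n) _ t0.
set X := sp_integral (S n) B t in fin_n En iS ES.
have iD : P.-integrable [set: W] (fun w => (I w - X w)%:E).
  by apply: eq_integrable (integrableB measurableT iI iS).
have mD := measurable_int _ iD.
have mD2 : measurable_fun [set: W] (fun w => ((I w - X w) ^+ 2)%:E).
  apply/measurable_EFinP; apply: measurable_funX; exact/measurable_EFinP.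
have -> : (\int[P]_w (I w)%:E = \int[P]_w (I w - X w)%:E)%E.
  by rewrite integralB_EFin// ES sube0.
apply: (le_trans (le_abse_integral _ _ _)) => //.
(* The inequality [|a| <= e/2 + a^2/(2e)] takes the place of Cauchy-Schwarz: as the mean of
   [(I - X)^2] is below [e^2], the two terms contribute at most [e/2] each. *)
apply: (@le_trans _ _ (\int[P]_w
    ((e / 2)%:E + (2 * e)^-1%:E * ((I w - X w) ^+ 2)%:E))%E).
  apply: ge0_le_integral_nonmeasurable => // w _.
  rewrite abse_EFin -EFinM -EFinD lee_fin -subr_ge0.
  have -> : e / 2 + (2 * e)^-1 * (I w - X w) ^+ 2 - `|I w - X w| =
      (2 * e)^-1 * (e - `|I w - X w|) ^+ 2.
    rewrite -[in LHS](real_normK (num_real (I w - X w))).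
    by field; rewrite gt_eqF.
  by rewrite mulr_ge0 ?sqr_ge0// invr_ge0 mulr_ge0// ltW.
rewrite ge0_integralD//; last 3 first.
- by move=> w _; rewrite lee_fin divr_ge0// ltW.
- by move=> w _; rewrite -EFinM lee_fin mulr_ge0 ?sqr_ge0// invr_ge0 mulr_ge0// ltW.
- by apply: measurable_funeM.
rewrite integral_cst//= probability_setT mule1 ge0_integralZl//; last 2 first.
- by move=> w _; rewrite lee_fin sqr_ge0.
- by rewrite lee_fin invr_ge0 mulr_ge0// ltW.
move: fin_n En; rewrite expectation.unlock => fin_n.
rewrite sub0r normrN => /(le_lt_trans (ler_norm _)) En.
rewrite -(fineK fin_n) -EFinM -EFinD lee_fin.
rewrite -lerBrDl (_ : e - e / 2 = (2 * e)^-1 * e ^+ 2); last first.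
  by field; rewrite gt_eqF.
by rewrite ler_wpM2l ?(ltW En)// invr_ge0 mulr_ge0// ltW.
Unshelve. all: by end_near. Qed.

End brownian_motion_theory.

(** * Admissible controls and their payoffs *)

Section control_problem_theory.
Context {R : realType}.
Implicit Types (u : R -> R) (r sigma l q : R).

Lemma admissible_widen sigma l1 l2 q d (W : measurableType d)
    (P : probability W R) F B lambda p :
  l1 <= l2 -> admissible sigma l1 q P F B lambda p ->
  admissible sigma l2 q P F B lambda p.
Proof.
move=> l12 [? ? ? lambda_le ? ? ? ? ? ?]; split => // t w t0.
have := lambda_le t w t0; rewrite !in_itv/= => /andP[-> /=] /le_trans; exact.
Qed.

(** Rational times are dense. The absolute value lets the hypothesis range over the countable type
    [rat] while visiting only nonnegative times. *)
Lemma continuous_eq_rat (f : R -> R) (a : R) :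
  {within `[0, +oo[%classic, continuous f} ->
  (forall x : rat, f `|ratr x| = a) -> forall t, 0 <= t -> f t = a.
Proof.
move=> cf fa t t0; apply/eqP/negPn/negP => /eqP fta.
have /subspace_continuousP/(_ t) := cf.
rewrite /= in_itv/= andbT => /(_ t0)/cvgrPdist_lt/(_ `|f t - a|).
rewrite normr_gt0 subr_eq0 => /(_ (introN eqP fta)).
rewrite /within/= => -[e /= e0 te].
(* The rational is taken to the right of [t], so that it is nonnegative even for [t = 0]. *)
have [x] := @rat_in_itvoo R t (t + e) ltac:(by rewrite ltrDl).
rewrite in_itv/= => /andP[tx xte].
have x0 : 0 <= ratr x :> R by rewrite (le_trans t0)// ltW.
have : `|f t - f (ratr x)| < `|f t - a|.
  apply: te; rewrite /ball_/= ?ltr_distlC ?in_itv/= ?x0//.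
  by apply/andP; split=> //; rewrite ltrBlDr (lt_trans tx)// ltrDl.
by have := fa x; rewrite (ger0_norm x0) => ->; rewrite ltxx.
Qed.

(** The payoff depends on whole paths, so one null set must serve all times: the exceptional sets of
    the rational times are united, and continuity of paths covers the other times. *)
Lemma admissible_start1 sigma l d (W : measurableType d)
    (P : probability W R) F B lambda p :
  admissible sigma l 1 P F B lambda p ->
  exists N : set W, [/\ measurable N, P N = 0%E &
    forall w, ~ N w -> forall t, 0 <= t -> p t w = 1].
Proof.
move=> adm; have FF := adm_filtration adm; have BM := adm_brownian adm.
have p_ae t : 0 <= t -> P.-negligible [set w | p t w <> 1].
  move=> t0; have mp : measurable_fun [set: W] (fun w => p t w - 1).
    apply: measurable_funB => //.
    by apply: (measurable_wrt_measurable_fun _ FF t) => //; exact: adm_p_adapted adm t t0.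
  have bp : [bounded p t w - 1 | w in [set: W]].
    exists 1; split=> // M M1 w _ /=; rewrite (le_trans _ (ltW M1))//.
    have := adm_p_range adm w t0; rewrite in_itv/= ler_norml => /andP[? ?]; lra.
  have ip : P.-integrable [set: W] (EFin \o (fun w => p t w - 1)).
    apply: measurable_bounded_integrable => //.
    by apply: le_lt_trans (probability_le1 P measurableT) _; rewrite ltry.
  have Ep := integral_ito_integral _ _ _ FF BM _ _ _ t0 (adm_sde adm t0) ip.
  (* Since [p t w - 1 <= 0], its absolute value integrates to minus its mean, which is 0. *)
  have abs0 : (\int[P]_w `|(p t w - 1)%R%:E| = 0)%E.
    transitivity (\int[P]_w - (p t w - 1)%R%:E)%E.
      apply: eq_integral => w _; rewrite abse_EFin ler0_norm//.
      have := adm_p_range adm w t0; rewrite in_itv/= => /andP[? ?]; lra.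
    by rewrite integralN ?Ep ?oppe0//; exact: integrable_add_def.
  have := (ae_eq_integral_abs P measurableT (measurable_int _ ip)).1 abs0.
  case=> N [mN N0 subN]; exists N; split=> // w /= pw; apply: subN => /= /(_ I) [].
  by move=> /eqP; rewrite subr_eq0 => /eqP.
(* An enumeration of the rationals by [nat]; integers that encode no rational are sent to 0, which
   merely repeats time 0. *)
pose x n : rat := odflt 0 (unpickle n).
have : P.-negligible (\bigcup_n [set w | p `|ratr (x n)| w <> 1]).
  by apply: negligible_bigcup => n; exact: p_ae.
case=> N [mN N0 subN]; exists N; split=> // w Nw.
apply: continuous_eq_rat; first exact: adm_p_continuous adm w.
move=> y; apply: contrapT => pw; apply: Nw; apply: subN.
by exists (pickle y) => //=; rewrite /x pickleK.
Qed.

Lemma measurable_discount r (D : set R) :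
  measurable_fun D (fun t : R => (expR (- r * t))%:E).
Proof. by apply/measurable_EFinP/measurableT_comp => //; exact: measurable_funM. Qed.

(** Multiplied by [r], the integrand is the exponential density, of total mass 1. *)
Lemma discount_integral r : 0 < r ->
  (\int[@lebesgue_measure R]_(t in `[0%R, +oo[) (expR (- r * t))%:E = r^-1%:E)%E.
Proof.
move=> r0; have := integral_exponential_pdf r0.
have -> : (\int[lebesgue_measure]_x (exponential_pdf r x)%:E =
  r%:E * \int[@lebesgue_measure R]_(t in `[0%R, +oo[) (expR (- r * t))%:E)%E.
  rewrite -ge0_integralZl//; last 2 first.
  - exact: measurable_discount.
  - by rewrite lee_fin ltW.
  rewrite integral_mkcond; apply: eq_integral => t _.
  by rewrite /exponential_pdf !patchE; case: ifP.
case: (integral _ _ _) => [a| |].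
- by move=> -[ra]; congr EFin; rewrite -[LHS](@mulKf _ r) ?gt_eqF// ra mulr1.
- by rewrite gt0_muley// lte_fin.
- by rewrite gt0_muleNy// lte_fin.
Qed.

Lemma discounted_norm_le u r M (f : R -> R) : 0 < r -> 0 <= M ->
  (forall x, x \in `[0, 1] -> `|u x| <= M) ->
  (forall t, 0 <= t -> f t \in `[0, 1]) ->
  `|r * \int[lebesgue_measure]_(t in `[0, +oo[) (expR (- r * t) * u (f t))| <= M.
Proof.
move=> r0 M0 uM f01.
have : (`|\int[lebesgue_measure]_(t in `[0%R, +oo[) (expR (- r * t) * u (f t))%:E| <=
    (r^-1 * M)%:E)%E.
  apply: (@abse_integral_le_nonmeasurable _ (measurableTypeR R) _ lebesgue_measure _ _
    (fun t : R => (expR (- r * t))%:E * M%:E)%E).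
    move=> t; rewrite /= in_itv/= andbT => t0.
    by rewrite lee_fin normrM ger0_norm ?expR_ge0// ler_wpM2l ?expR_ge0 ?uM ?f01.
  rewrite ge0_integralZr//; last first.
    exact: measurable_discount.
  by rewrite discount_integral.
rewrite /Rintegral; case: (integral _ _ _) => [a| |]//.
by rewrite lee_fin normrM (gtr0_norm r0) ler_pdivlMl.
Qed.

Lemma discounted_cst u r q (f : R -> R) : 0 < r ->
  (forall t, 0 <= t -> f t = q) ->
  r * \int[lebesgue_measure]_(t in `[0, +oo[) (expR (- r * t) * u (f t)) = u q.
Proof.
move=> r0 fq; rewrite /Rintegral.
have -> : (\int[lebesgue_measure]_(t in `[0%R, +oo[) (expR (- r * t) * u (f t))%:E =
    \int[lebesgue_measure]_(t in `[0%R, +oo[) ((u q)%:E * (expR (- r * t))%:E))%E.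
  apply: eq_integral => t; rewrite inE/= in_itv/= andbT => t0.
  by rewrite fq// -EFinM mulrC.
rewrite integralZl//; last first.
  apply/integrableP; split.
    exact: measurable_discount.
  have -> : (\int[lebesgue_measure]_(t in `[0%R, +oo[) `|(expR (- r * t))%:E| =
      r^-1%:E)%E.
    rewrite -discount_integral//; apply: eq_integral => t _.
    by rewrite abse_EFin ger0_norm ?expR_ge0.
  by rewrite ltry.
by rewrite discount_integral//= mulrCA divff ?mulr1// gt_eqF.
Qed.

(** The weight [r * expR (- r * t)] has total mass 1, so every path yields at most [M] in absolute
    value. This uniform bound is what gives the supremum in [value] a meaning. *)
Lemma payoff_norm_le u r M d (W : measurableType d) (P : probability W R) p :
  0 < r -> 0 <= M -> (forall x, x \in `[0, 1] -> `|u x| <= M) ->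
  (forall t w, 0 <= t -> p t w \in `[0, 1]) -> `|payoff u r P p| <= M.
Proof.
move=> r0 M0 uM p01; rewrite /payoff expectation.unlock.
have : (`|\int[P]_w (r * \int[lebesgue_measure]_(t in `[0, +oo[)
    (expR (- r * t) * u (p t w)))%:E| <= M%:E)%E.
  apply: (@abse_integral_le_nonmeasurable _ _ _ _ _ _ (cst M%:E)) => [w _|].
    by rewrite lee_fin discounted_norm_le// => t; exact: p01.
  by rewrite integral_cst//= probability_setT mule1.
by case: (integral _ _ _) => //= ; rewrite ?leeNl ?leye_eq.
Qed.

Lemma payoff_ae_cst u r q d (W : measurableType d) (P : probability W R) p
    (N : set W) : 0 < r -> measurable N -> P N = 0%E ->
  (forall w, ~ N w -> forall t, 0 <= t -> p t w = q) -> payoff u r P p = u q.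
Proof.
move=> r0 mN N0 pq; rewrite /payoff expectation.unlock.
rewrite (@ae_eq_integral_nonmeasurable _ _ _ _ _ (cst (u q)%:E) N)//.
  by rewrite integral_cst//= probability_setT mule1.
by move=> w Nw; rewrite (discounted_cst _ _ q)//; exact: pq.
Qed.

End control_problem_theory.

(** * Attainable payoffs and the value function *)

Section value_theory.
Context {R : realType}.
Implicit Types (u : R -> R) (r sigma l q : R).

Lemma measurable_wrt_cst d (T : measurableType d) (G : set (set T)) q :
  sigma_algebra [set: T] G -> measurable_wrt G (cst q : T -> R).
Proof.
move=> [G0 GC _] _ [A _ <-]; rewrite setTI preimage_cst.
by case: ifP => _ //; rewrite -(setD0 [set: T]); exact: GC.
Qed.

(** Under the control 0 the integrand of the stochastic equation vanishes, and so does its Ito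
    integral, whatever the Brownian motion. *)
Lemma admissible_cst sigma l q d (W : measurableType d)
    (P : probability W R) F B : 0 <= l -> q \in `[0, 1] ->
  filtration F -> brownian_motion P F B ->
  admissible sigma l q P F B (fun _ _ => 0) (fun _ _ => q).
Proof.
move=> l0 q01 FF BM.
have F_cst t c : 0 <= t -> measurable_wrt (F t) (cst c : W -> R).
  by move=> t0; apply: measurable_wrt_cst; have [] := FF.1 t t0.
split => //.
- exact: measurable_cst.
- by move=> t w _; rewrite in_itv/= lexx.
- by move=> t _; apply: measurable_wrt_cst; exact: smallest_sigma_algebra.
- by move=> t t0; exact: F_cst.
- by move=> w; apply: continuous_subspaceT => x; exact: cst_continuous.
move=> t t0; have -> : (fun (s : R) (w : W) =>
    Num.sqrt 0 * (q * (1 - q) / sigma)) = (fun _ => cst 0).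
  by apply/funext => s; apply/funext => w; rewrite sqrtr0 mul0r.
split; [exact: measurable_cst|by move=> s; exact: F_cst|exact: measurable_cst|].
have sb (i : nat) : exists M : R, forall w : W, `|(cst 0 : W -> R) w| <= M.
  by exists 0 => w; rewrite normr0.
(* The simple process with no interval: it is 0 and its elementary integral is 0, so both
   approximating sequences are constantly 0. *)
pose S0 : simple_process F := @SimpleProcess R d W F 0%N (fun=> 0) (fun=> cst 0)
  (lexx 0) (fun _ _ _ => lexx 0) sb (fun=> F_cst 0 0 (lexx 0)).
exists (fun=> S0); split.
  rewrite (_ : (fun _ => _) = cst 0%E); first exact: cvg_cst.
  apply/funext => _ /=; apply: integral0_eq => w _; apply: integral0_eq => s _.
  by rewrite /sp_fun big_ord0 subrr expr0n.
rewrite (_ : (fun _ => _) = cst 0%E); first exact: cvg_cst.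
apply/funext => _ /=; rewrite expectation.unlock; apply: integral0_eq => w _.
by rewrite /sp_integral big_ord0 subrr subr0 expr0n.
Qed.

Definition attainable u r sigma l q : set R :=
  [set y : R | exists (d : measure_display) (W : measurableType d)
                      (P : probability W R) (F : R -> set (set W))
                      (B lambda p : R -> W -> R),
                 admissible sigma l q P F B lambda p /\
                 y = payoff u r P p].

Lemma valueE u r sigma l q : value u r sigma l q = sup (attainable u r sigma l q).
Proof. by []. Qed.

Lemma attainable_widen u r sigma l1 l2 q : l1 <= l2 ->
  attainable u r sigma l1 q `<=` attainable u r sigma l2 q.
Proof.
move=> l12 y [d [W [P [F [B [lambda [p [adm ->]]]]]]]].
by exists d, W, P, F, B, lambda, p; split=> //; exact: admissible_widen adm.
Qed.

Lemma attainable_norm_le u r sigma l q M : 0 < r -> 0 <= M ->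
  (forall x, x \in `[0, 1] -> `|u x| <= M) ->
  forall y, attainable u r sigma l q y -> `|y| <= M.
Proof.
move=> r0 M0 uM _ [d [W [P [F [B [lambda [p [adm ->]]]]]]]].
by apply: payoff_norm_le => // t w; exact: adm_p_range adm t w.
Qed.

Lemma attainable_cst u r sigma l q l' q' : 0 < r -> 0 <= l -> q \in `[0, 1] ->
  attainable u r sigma l' q' !=set0 -> attainable u r sigma l q (u q).
Proof.
move=> r0 l0 q01 [_ [d [W [P [F [B [lambda [p [adm _]]]]]]]]].
exists d, W, P, F, B, (fun _ _ => 0), (fun _ _ => q); split.
  apply: admissible_cst => //; [exact: adm_filtration adm|exact: adm_brownian adm].
by rewrite (@payoff_ae_cst _ _ _ q _ _ _ _ set0)//; exact: measure0.
Qed.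

Lemma attainable_start1 u r sigma l y : 0 < r ->
  attainable u r sigma l 1 y -> y = u 1.
Proof.
move=> r0 [d [W [P [F [B [lambda [p [adm ->]]]]]]]].
have [N [mN N0 pN]] := admissible_start1 _ _ _ _ _ _ _ _ _ adm.
exact: payoff_ae_cst mN N0 pN.
Qed.

End value_theory.

Theorem proposition2 (R : realType) (u : R -> R) (r sigma p0 : R)
    (u_bounded : [bounded u x | x in `[0, 1]%classic])
    (u_pc : piecewise_continuous u)
    (u_usc : upper_semicontinuous u)
    (r_gt0 : 0 < r) (sigma_gt0 : 0 < sigma) (p0_01 : p0 \in `[0, 1])
    (lambda1 lambda2 : R) (lambda1_gt0 : 0 < lambda1)
    (lambda12 : lambda1 <= lambda2) :
  pminus u r sigma p0 lambda2 <= pminus u r sigma p0 lambda1 /\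
  pplus u r sigma p0 lambda1 <= pplus u r sigma p0 lambda2.
Proof.
have [M M0 uM] : exists2 M, 0 <= M & forall x, x \in `[0, 1] -> `|u x| <= M.
  (* Boundedness provides bounds strictly above some real [M], possibly negative; [|M| + 1] is such
     a bound and is nonnegative. *)
  case: u_bounded => M [_ uM]; exists (`|M| + 1); first by rewrite addr_ge0.
  by move=> x x01; apply: (uM (`|M| + 1)) => //; rewrite ltr_pwDr// ler_norm.
have lambda2_gt0 : 0 < lambda2 by exact: lt_le_trans lambda12.
have [p0_ge0 p0_le1] : 0 <= p0 /\ p0 <= 1 by move: p0_01; rewrite in_itv/= => /andP.
(* In the second case no probability space carries a Brownian motion, and both
   value functions are the junk value sup set0 = 0. *)
have [[l [q ne]]|no_bm] :=
    pselect (exists l q, attainable u r sigma l q !=set0); last first.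
  have value0 l q : value u r sigma l q = 0.
    rewrite valueE (_ : attainable _ _ _ _ _ = set0) ?sup0//.
    by apply/seteqP; split => // y ay; case: no_bm; exists l, q, y.
  rewrite /pminus /pplus (_ : value u r sigma lambda2 = value u r sigma lambda1)//.
  by apply/funext => q; rewrite !value0.
have has_sup_att l' q' : 0 < l' -> q' \in `[0, 1] ->
    has_sup (attainable u r sigma l' q').
  move=> l'0 q'01; split.
    by exists (u q'); apply: attainable_cst ne => //; exact: ltW.
  exists M => y /(attainable_norm_le _ _ _ _ _ _ r_gt0 M0 uM).
  exact: le_trans (ler_norm _).
have u_le_value l' q' : 0 < l' -> q' \in `[0, 1] -> u q' <= value u r sigma l' q'.
  move=> l'0 q'01; rewrite valueE; apply: ub_le_sup.
    by case: (has_sup_att _ _ l'0 q'01).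
  by apply: attainable_cst ne => //; exact: ltW.
have stop_sub q' : q' \in `[0, 1] ->
    value u r sigma lambda2 q' = u q' -> value u r sigma lambda1 q' = u q'.
  move=> q'01 v2; apply/eqP; rewrite eq_le u_le_value// andbT -v2 !valueE.
  apply: le_sup.
  - by move=> y /(attainable_widen _ _ _ _ _ _ lambda12) ay; exists y.
  - by case: (has_sup_att _ _ lambda1_gt0 q'01).
  - exact: has_sup_att.
have value1 l' : 0 < l' -> value u r sigma l' 1 = u 1.
  move=> l'0; rewrite valueE (_ : attainable _ _ _ _ _ = [set u 1]) ?sup1//.
  apply/seteqP; split=> [y /attainable_start1 -> //|_ ->].
  by apply: attainable_cst ne => //; [exact: ltW|rewrite in_itv/= ler01 lexx].
split.
- have ub1 : has_ubound [set p | p \in `[0, p0] /\ value u r sigma lambda1 p = u p].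
    by exists p0 => p []; rewrite in_itv/= => /andP[].
  have sub p : p \in `[0, p0] /\ value u r sigma lambda2 p = u p ->
               p \in `[0, p0] /\ value u r sigma lambda1 p = u p.
    move=> [p_itv v2]; split=> //; apply: stop_sub => //.
    by move: p_itv; rewrite !in_itv/= => /andP[-> /le_trans]; exact.
  rewrite /pminus; set S2 := [set p | _ /\ value u r sigma lambda2 p = u p].
  set S1 := [set p | _ /\ value u r sigma lambda1 p = u p].
  have [->|/set0P[x S2x]] := eqVneq S2 set0.
    (* The left side is the default value 0; the right side is also 0 if [S1] is empty, and
       otherwise bounds a nonnegative element of [S1]. *)
    rewrite sup0; have [->|/set0P[x S1x]] := eqVneq S1 set0; first by rewrite sup0.
    apply: le_trans (ub_le_sup ub1 S1x).
    by case: S1x; rewrite in_itv/= => /andP[].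
  apply: le_sup => //; [|by exists x|].
    by move=> y /sub ay; exists y.
  by split=> //; exists x; exact: sub.
(* The point 1 makes the set for [lambda2] nonempty, so its infimum is a genuine one and it suffices
   to bound each of its elements from below. *)
- have S2_1 : 1 \in `[p0, 1] /\ value u r sigma lambda2 1 = u 1.
    by split; [rewrite in_itv/= p0_le1 lexx|exact: value1].
  apply: lb_le_inf; first by exists 1.
  move=> p [p_itv v2]; apply: ge_inf.
    by exists p0 => x []; rewrite in_itv/= => /andP[].
  split=> //; apply: stop_sub => //; move: p_itv; rewrite !in_itv/=.
  by move=> /andP[p0p ->]; rewrite (le_trans p0_ge0).
Qed.
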